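(* Let $P$ be the marginal Metropolis--Hastings kernel with target $\pi$, proposal $q$ and acceptance ratio $r$, and let $\tilde P$ be the associated pseudo-marginal kernel with weight distributions $\{Q_x\}_{x\in\mathsf X}$. Suppose that the one-step expected acceptance probability of the marginal algorithm is bounded away from zero, $$\alpha_0:=\inf_{x\in\mathsf X}\int q(x,\mathrm dy)\min\{1,r(x,y)\}>0,$$ and that there exists a nondecreasing convex function $\phi:[0,\infty)\to[1,\infty)$ satisfying $$\liminf_{t\to\infty}\frac{\phi(t)}t=\infty\quad\text{and}\quad M_W:=\sup_{x\in\mathsf X}\int\phi(w)Q_x(\mathrm dw)<\infty.$$ Then there exist constants $\delta>0$ and $\bar w\in(1,\infty)$ such that, for all $x\in\mathsf X$ and $w\in\mathsf W$, $w>0$, $$\tilde PV(x,w)\le V(w)-\delta\frac{V(w)}w\mathbb I\{w\in[\bar w,\infty)\}+M_W\mathbb I\{w\in(0,\bar w)\},$$ where $V(x,w):=V(w):=\phi(w)$. The constants $\delta$ and $\bar w$ can be chosen to depend on $\alpha_0$, $\phi$ and $M_W$ only.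
   Context: Let $(\mathsf X,\mathcal B(\mathsf X))$ be a measurable space, $\pi$ a probability measure on it and $q(x,\mathrm dy)$ a Markov kernel on $\mathsf X$. The function $r(x,y)=\frac{\pi(\mathrm dy)q(y,\mathrm dx)}{\pi(\mathrm dx)q(x,\mathrm dy)}$ is the Radon--Nikodym derivative in the sense of Tierney: there is a symmetric measurable set $R\subset\mathsf X^2$ on which the measures $\pi(\mathrm dx)q(x,\mathrm dy)$ and $\pi(\mathrm dy)q(y,\mathrm dx)$ are mutually absolutely continuous, and on whose complement they are mutually singular; on $R$, $r$ is the density of the second with respect to the first, with values in $(0,\infty)$ and $r(x,y)r(y,x)=1$; off $R$, $r:=0$. The marginal kernel is $P(x,\mathrm dy)=\min\{1,r(x,y)\}q(x,\mathrm dy)+\delta_x(\mathrm dy)\rho(x)$ with $\rho(x)=1-\int\min\{1,r(x,y)\}q(x,\mathrm dy)$. Let $\mathsf W$ be a Borel subset of $\mathbb R_+=[0,\infty)$ and let $x\mapsto Q_x$ be a probability kernel from $\mathsf X$ to $\mathsf W$ with $\int w\,Q_x(\mathrm dw)=1$ for all $x$. The pseudo-marginal kernel is $\tilde P(x,w;\mathrm dy,\mathrm du)=\min\{1,r(x,y)\frac uw\}q(x,\mathrm dy)Q_y(\mathrm du)+\delta_{x,w}(\mathrm dy,\mathrm du)\tilde\rho(x,w)$ with $\tilde\rho(x,w)=1-\iint\min\{1,r(x,y)\frac uw\}q(x,\mathrm dy)Q_y(\mathrm du)$, and $\tilde PV(x,w)=\int\tilde P(x,w;\mathrm dy,\mathrm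 du)V(y,u)$. *)

(* Defs.v *)
From HB Require Import structures.
From mathcomp Require Import all_boot all_order all_algebra.
From mathcomp Require Import all_classical all_reals all_analysis.
From mathcomp Require Import measurable_realfun.

Set Implicit Arguments.
Unset Strict Implicit.
Unset Printing Implicit Defensive.

Import Order.TTheory GRing.Theory Num.Theory.
Import numFieldNormedType.Exports.

Local Open Scope classical_set_scope.
Local Open Scope ring_scope.

(* The set of weights: a Borel subset of [0, +oo[, nonempty since measurable
   types are pointed. *)
Record weight_set (R : realType) := WeightSet {
  wset :> set R ;
  wset_measurable : measurable wset ;
  wset_ge0 : wset `<=` `[0, +oo[ ;
  wset_neq0 : wset !=set0 }.

Section weight_space.
Context (R : realType) (W : weight_set R).

Definition weight_space : Type := {w : R | w \in (W : set R)}.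
Definition wval (w : weight_space) : R := \val w.

HB.instance Definition _ := Choice.on weight_space.

Let weight_point : weight_space :=
  exist _ (projT1 (cid (wset_neq0 W))) (mem_set (projT2 (cid (wset_neq0 W)))).

HB.instance Definition _ := isPointed.Build weight_space weight_point.

(* The trace on [W] of the Borel sigma-algebra. *)
HB.instance Definition _ :=
  Measurable.copy weight_space (g_sigma_algebra_preimageType wval).

Lemma measurable_wval : measurable_fun [set: weight_space] wval.
Proof. by move=> _ B mB; exists B. Qed.

Lemma wval_ge0 (w : weight_space) : 0 <= wval w.
Proof. by have /set_mem/wset_ge0 := valP w; rewrite /= in_itv/= andbT. Qed.

End weight_space.

Section mh.
Local Open Scope ereal_scope.
Context (d : measure_display) (X : measurableType d) (R : realType).
Implicit Types (pi : probability X R) (q : R.-pker X ~> X).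

Lemma measurable_cst_prob pi :
  measurable_fun [set: unit] (cst pi : unit -> pprobability X R).
Proof. exact: measurable_cst. Qed.

(* The measure pi(dx) q(x,dy) on pairs (x,y); [pi] is viewed as a kernel from
   the one-point space, so as to use the library's product of kernels. *)
Definition joint pi q : {measure set (X * X) -> \bar R} :=
  mkproduct (kprobability (measurable_cst_prob pi)) (kernel.kernel_snd q) tt.

(* The measure pi(dy) q(y,dx) on pairs (x,y). *)
Definition joint_rev pi q : set (X * X) -> \bar R :=
  pushforward (joint pi q) (fun z : X * X => (z.2, z.1)).

(* Density of [joint_rev] with respect to [joint], in the sense of Tierney. *)
Record mh_ratio pi q := MHRatio {
  ratio_set : set (X * X) ;
  ratio_fun :> X * X -> R ;
  ratio_set_measurable : measurable ratio_set ;
  ratio_set_sym : forall x y, ratio_set (x, y) -> ratio_set (y, x) ;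
  ratio_set_equiv : forall A, measurable A -> A `<=` ratio_set ->
    joint pi q A = 0 <-> joint_rev pi q A = 0 ;
  ratio_set_singular : exists N, [/\ measurable N, N `<=` ~` ratio_set,
    joint pi q N = 0 & joint_rev pi q (~` ratio_set `\` N) = 0] ;
  ratio_measurable : measurable_fun [set: X * X] ratio_fun ;
  ratio_density : forall A, measurable A -> A `<=` ratio_set ->
    joint_rev pi q A = \int[joint pi q]_(z in A) (ratio_fun z)%:E ;
  ratio_gt0 : forall z, ratio_set z -> (0 < ratio_fun z)%R ;
  ratio_inv : forall x y, ratio_set (x, y) ->
    (ratio_fun (x, y) * ratio_fun (y, x) = 1)%R ;
  ratio_out : forall z, ~ ratio_set z -> ratio_fun z = 0%R }.

Lemma ratio_ge0 pi q (r : mh_ratio pi q) z : (0 <= r z)%R.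
Proof.
have [rz|rz] := pselect (ratio_set r z); first exact/ltW/ratio_gt0.
by rewrite ratio_out.
Qed.

(* Expected one-step acceptance probability of the marginal chain at [x]. *)
Definition mh_accept_prob pi q (r : mh_ratio pi q) (x : X) : \bar R :=
  \int[q x]_y (Num.min 1 (r (x, y)))%:E.

End mh.

Section pseudo_marginal.
Local Open Scope ereal_scope.
Context (d : measure_display) (X : measurableType d) (R : realType)
  (pi : probability X R) (q : R.-pker X ~> X) (r : mh_ratio pi q)
  (W : weight_set R) (Q : R.-pker X ~> weight_space W).

Local Notation XW := (X * weight_space W)%type.

(* For [wval z.2 = 0] this is 0, since division by 0 yields 0. *)
Definition pm_accept (z z' : XW) : R :=
  Num.min 1%R (r (z.1, z'.1) * (wval z'.2 / wval z.2))%R.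

(* The measure q(x,dy) Q_y(du) on pairs (y,u). *)
Definition pm_proposal (x : X) : {measure set XW -> \bar R} :=
  mkproduct q (kernel.kernel_snd Q) x.

Definition pm_reject_prob (z : XW) : \bar R :=
  1 - \int[pm_proposal z.1]_z' (pm_accept z z')%:E.

Definition pm_kernel_fun (z : XW) (A : set XW) : \bar R :=
  \int[pm_proposal z.1]_(z' in A) (pm_accept z z')%:E
  + pm_reject_prob z * \d_z A.

Lemma pm_accept_ge0 z z' : (0 <= pm_accept z z')%R.
Proof.
by rewrite le_min ler01/= mulr_ge0 ?ratio_ge0// divr_ge0// wval_ge0.
Qed.

Lemma pm_accept_le1 z z' : (pm_accept z z' <= 1)%R.
Proof. by rewrite ge_min lexx. Qed.

Lemma measurable_pm_accept z : measurable_fun [set: XW] (pm_accept z).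
Proof.
apply: (measurable_minr (f := cst 1%R)); first exact: measurable_cst.
apply: measurable_funM.
  apply: (measurableT_comp (ratio_measurable r)).
  apply/measurable_fun_pairP; split.
    exact: measurable_cst.
  exact: measurable_fst.
apply: measurable_funM; last exact: measurable_cst.
apply: measurableT_comp; [exact: measurable_wval|exact: measurable_snd].
Qed.

Lemma pm_proposalT x : pm_proposal x [set: XW] = 1.
Proof.
rewrite /pm_proposal /mkproduct /= /kproduct.
under eq_integral do rewrite kernel.intker_indicE//.
transitivity (\int[q x]_y (cst 1 y)); last by rewrite integral_cst// prob_kernel mul1e.
apply: eq_integral => y _.
rewrite /kernel.kernel_snd/=.
rewrite (_ : xsection _ _ = setT) ?prob_kernel//.
by apply/seteqP; split => // u _; rewrite /xsection/= in_setT.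
Qed.

Lemma pm_reject_prob_ge0 z : 0 <= pm_reject_prob z.
Proof.
rewrite sube_ge0 ?fin_num1 ?orbT//.
rewrite -(pm_proposalT z.1) -[leRHS]mul1e -(integral_cst (pm_proposal z.1))//.
apply: ge0_le_integral => //.
- by move=> z' _; rewrite lee_fin pm_accept_ge0.
- by apply/measurable_EFinP; exact: measurable_pm_accept.
- by move=> z' _; rewrite lee_fin pm_accept_le1.
Qed.

Lemma pm_reject_prob_le1 z : pm_reject_prob z <= 1.
Proof.
rewrite -[leRHS]sube0 leeB// integral_ge0// => z' _.
by rewrite lee_fin pm_accept_ge0.
Qed.

Let pm_kernel0 z : pm_kernel_fun z set0 = 0.
Proof. by rewrite /pm_kernel_fun integral_set0 measure0 mule0 adde0. Qed.

Let pm_kernel_ge0 z A : 0 <= pm_kernel_fun z A.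
Proof.
rewrite adde_ge0//; last by rewrite mule_ge0// pm_reject_prob_ge0.
by apply: integral_ge0 => z' _; rewrite lee_fin pm_accept_ge0.
Qed.

Let pm_kernel_sigma_additive z : semi_sigma_additive (pm_kernel_fun z).
Proof.
move=> F mF tF mUF.
under eq_fun do rewrite big_split/=.
have rho_fin : pm_reject_prob z \is a fin_num.
  by rewrite ge0_fin_numE ?pm_reject_prob_ge0// (le_lt_trans (pm_reject_prob_le1 z)) ?ltry.
apply: cvgeD.
- apply: ge0_adde_def; rewrite inE ?mule_ge0 ?pm_reject_prob_ge0//.
  by apply: integral_ge0 => z' _; rewrite lee_fin pm_accept_ge0.
- apply: semi_sigma_additive_nng_induced => //.
    by apply/measurable_EFinP; exact: measurable_pm_accept.
  by move=> z'; rewrite lee_fin pm_accept_ge0.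
- under eq_fun do rewrite -ge0_sume_distrr//.
  apply: cvgeZl => //.
  exact: measure_semi_sigma_additive.
Qed.

HB.instance Definition _ z := isMeasure.Build _ _ _ (pm_kernel_fun z)
  (pm_kernel0 z) (pm_kernel_ge0 z) (@pm_kernel_sigma_additive z).

Definition pm_kernel : XW -> {measure set XW -> \bar R} := pm_kernel_fun.

End pseudo_marginal.

(* Main.v *)
Require Import Defs.
From mathcomp Require Import all_boot all_order all_algebra.
From mathcomp Require Import all_classical all_reals all_analysis.
From mathcomp Require Import measurable_realfun ring lra.

(** Write [a] for the acceptance probability [min 1 (r(x,y) u/w)] of the proposal
[(y,u)] at [(x,w)].  The pseudo-marginal chain moves to [(y,u)] with probability
[a] and stays at [(x,w)] with probability [1 - a], so its kernel is the average
over the proposal of the two-point laws [a d_(y,u) + (1 - a) d_(x,w)], and the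
integral of [phi(u)] under it is the average of [a phi(u) + (1 - a) phi(w)]
([integral_pm_kernel]).  This never exceeds [phi(w) + phi(u)], which gives the
bound for small [w] ([pm_kernel_phi_le]).

For large [w] one has to gain a multiple of [phi(w)/w].  Fix a level [s]; once
[w] is so large that [phi(w) >= 2 phi(s)], accepting a weight [u <= s] lowers
[phi] by at least [phi(w)/2], and such a weight is accepted with probability at
least [min 1 r * u/w].  Hence, pointwise in the proposal ([drift_pointwise]),

  [a phi(u) + (1 - a) phi(w) + phi(w)/(2 w) * min 1 r * u 1{u <= s}
     <= phi(w) + phi(u)].

Superlinearity of [phi] and the bound [M_W] make the weights uniformly
integrable: some [s] satisfies [E u 1{u <= s} >= 1/2] for every weight law
([truncated_weight_mean_ge]).  Averaging over the proposal, the gain is at least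
[phi(w)/(2 w) * alpha0 / 2], against a loss of [M_W] ([pm_kernel_phi_drift]).
Since [phi(w)/w] tends to infinity, half of the gain eventually absorbs the loss,
which leaves [delta = alpha0 / 8]. *)

Set Implicit Arguments.
Unset Strict Implicit.
Unset Printing Implicit Defensive.

Import Order.TTheory GRing.Theory Num.Theory.
Import numFieldNormedType.Exports.

Local Open Scope classical_set_scope.
Local Open Scope ring_scope.

(** * Integration against a mixture of measures *)

Section mixture.
Local Open Scope ereal_scope.
Context d d' (S : measurableType d) (T : measurableType d') (R : realType).
Variables (m : {measure set S -> \bar R}) (k : S -> {measure set T -> \bar R})
  (mu : {measure set T -> \bar R}).
Hypothesis mk : forall A, measurable A -> measurable_fun [set: S] (k ^~ A).
Hypothesis muE : forall A, measurable A -> mu A = \int[m]_s k s A.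

Import HBNNSimple.

Let sintegral_mixture (h : {nnsfun T >-> R}) :
  sintegral mu h = \int[m]_s sintegral (k s) h.
Proof.
under eq_integral do rewrite sintegralE.
rewrite ge0_integral_fsum//; last 2 first.
  by move=> r; apply: measurable_funeM; exact: mk.
  by move=> n x _; exact: nnsfun_mulemu_ge0.
rewrite sintegralE /=; apply: eq_fsbigr => // r /[!inE] -[t _ <-].
by rewrite muE// ge0_integralZl//; [exact: mk|rewrite lee_fin].
Qed.

(** The formula holds for simple functions by linearity and passes to
nonnegative functions by monotone convergence, used once for [mu] and twice for
the iterated integral. *)
Lemma ge0_integral_mixture (f : T -> \bar R) :
    measurable_fun [set: T] f -> (forall t, 0 <= f t) ->
  \int[mu]_t f t = \int[m]_s \int[k s]_t f t.
Proof.
move=> mf f0; pose g n := EFin \o nnsfun_approx measurableT mf n.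
have mg n : measurable_fun [set: T] (g n) by exact/measurable_EFinP.
have g0 n t : 0 <= g n t by rewrite lee_fin.
have ndg t : {homo g ^~ t : a b / (a <= b)%O >-> a <= b}.
  by move=> *; exact/lefP/nd_nnsfun_approx.
have fE t : f t = limn (g ^~ t).
  by apply/esym/cvg_lim => //; exact: cvg_nnsfun_approx.
have limE (nu : {measure set T -> \bar R}) :
    \int[nu]_t f t = limn (fun n => \int[nu]_t g n t).
  by rewrite -monotone_convergence//; apply: eq_integral => t _; exact: fE.
rewrite limE; under [RHS]eq_integral do rewrite limE.
rewrite monotone_convergence//; last 3 first.
- by move=> n; exact: measurable_fun_integral_kernel.
- by move=> n s _; exact: integral_ge0.
- by move=> s _ a b ab; apply: ge0_le_integral => // t _; exact: ndg.
apply: congr_lim; apply/funext => n.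
rewrite integralT_nnsfun sintegral_mixture; apply: eq_integral => s _.
by rewrite integralT_nnsfun.
Qed.

End mixture.

(** * Real estimates on the Lyapunov function *)

Section growth.
Context (R : realType) (phi : R -> R).
Hypothesis phi_ge1 : forall t, 0 <= t -> 1 <= phi t.
Hypothesis phi_nd : {in `[0, +oo[ &, {homo phi : s t / s <= t}}.

Lemma superlinear_ge K :
  limf_einf (fun t : R => (phi t / t)%:E) +oo%R = +oo%E ->
  exists2 s, 0 < s & forall t, s < t -> K * t <= phi t.
Proof.
rewrite limf_einfE => sup_oo.
have := ltry K; rewrite -[X in (_ < X)%E]sup_oo.
move=> /ereal_sup_gt[_ [V [M [_ MV]] <-] KV].
exists (Num.max M 1); first by rewrite lt_max ltr01 orbT.
move=> t; rewrite gt_max => /andP[Mt t1].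
rewrite -ler_pdivlMr ?(lt_trans ltr01)// -lee_fin.
by apply: (le_trans (ltW KV)); apply: ereal_inf_lbound; exists t => //; exact: MV.
Qed.

Let phi_ge0 t : 0 <= t -> 0 <= phi t.
Proof. by move=> /phi_ge1; exact: le_trans. Qed.

Lemma measurable_phi_wval (W : weight_set R) :
  measurable_fun [set: weight_space W] (fun u => (phi (wval u))%:E).
Proof.
have -> : (fun u : weight_space W => (phi (wval u))%:E) =
    EFin \o (fun t => phi (Num.max 0 t)) \o @wval R W.
  (* [phi] is monotone on nonnegative reals only; truncating its argument at 0
     makes it monotone everywhere without changing it on weights. *)
  by apply/funext => u /=; rewrite max_r// wval_ge0.
apply: measurableT_comp; last exact: measurable_wval.
apply/measurable_EFinP; apply: nondecreasing_measurable => // s t st.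
apply: phi_nd; rewrite ?in_itv/= ?andbT; [by rewrite le_max lexx..|].
by rewrite ge_max !le_max lexx st orbT.
Qed.

(** If [u > s], the correction term vanishes and [a phi(u) <= phi(u)] suffices.
If [u <= s], then [phi(u) <= phi(w)/2] and [u < w], so that
[a >= min 1 rho * u/w]: replacing [phi(w)] by [phi(u)] with probability [a]
saves at least [a phi(w)/2], which pays for the correction term. *)
Lemma drift_pointwise (w u rho s : R) (a := Num.min 1 (rho * (u / w))) :
    0 < w -> 0 <= u -> 0 <= rho -> 0 <= s -> 2 * phi s <= phi w ->
  (a * phi u + (1 - a) * phi w) +
    phi w / (2 * w) * (Num.min 1 rho * (u * \1_(`]-oo, s]) u))
  <= phi w + phi u.
Proof.
move=> w0 u0 rho0 s0 sw.
have uw0 : 0 <= u / w by rewrite divr_ge0// ltW.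
have a0 : 0 <= a by rewrite le_min ler01 mulr_ge0.
have a1 : a <= 1 by rewrite ge_min lexx.
have pu0 := phi_ge0 u0; have pw0 := phi_ge0 (ltW w0).
have auphi : a * phi u <= phi u by rewrite ler_piMl.
have awphi : 0 <= a * phi w by rewrite mulr_ge0.
rewrite indicE; case: (boolP (u \in _)) => [|_]; last first.
  by rewrite !mulr0 addr0; lra.
rewrite inE/= in_itv/= => us; rewrite mulr1.
have us_phi : phi u <= phi s by apply: phi_nd => //; rewrite in_itv/= andbT.
have uw1 : u / w <= 1.
  (* Otherwise [w < u <= s] and [phi w <= phi s], against [2 * phi s <= phi w]. *)
  rewrite ler_pdivrMr// mul1r leNgt; apply/negP => wu.
  have : phi w <= phi s.
    by apply: phi_nd; rewrite ?in_itv/= ?andbT// ?(ltW w0)// (le_trans (ltW wu)).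
  by have := phi_ge1 s0; lra.
have mle : Num.min 1 rho * (u / w) <= a.
  rewrite le_min; apply/andP; split.
    by rewrite (le_trans _ uw1)// ler_piMl// ge_min lexx.
  by rewrite ler_wpM2r// ge_min lexx orbT.
have -> : phi w / (2 * w) * (Num.min 1 rho * u) =
    phi w / 2 * (Num.min 1 rho * (u / w)).
  by field; rewrite gt_eqF.
have : phi w / 2 * (Num.min 1 rho * (u / w)) <= phi w / 2 * a.
  by rewrite ler_wpM2l// divr_ge0.
have : a * phi u <= a * (phi w / 2) by rewrite ler_wpM2l//; lra.
lra.
Qed.

End growth.

(** * Integration against the proposal and the pseudo-marginal kernel *)

Section kernels.
Local Open Scope ereal_scope.
Context (d : measure_display) (X : measurableType d) (R : realType)
  (pi : probability X R) (q : R.-pker X ~> X) (r : mh_ratio pi q)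
  (W : weight_set R) (Q : R.-pker X ~> weight_space W).
Local Notation XW := (X * weight_space W)%type.

(** The proposal is the mixture over [q x] of the images of the laws [Q y] under
[u |-> (y, u)]. *)
Lemma integral_pm_proposal x (f : XW -> \bar R) :
    measurable_fun [set: XW] f -> (forall z, 0 <= f z) ->
  \int[pm_proposal q Q x]_z f z = \int[q x]_y \int[Q y]_u f (y, u).
Proof.
move=> mf f0.
(* The measure structure of a pushforward takes the measurability of the map as
   an argument, over which [pushQ] is abstracted. *)
pose pushQ := fun y => pushforward (Q y) (pair y) : {measure set XW -> \bar R}.
pose k := pushQ (@pair1_measurable _ _ X (weight_space W)).
have kE A y : measurable A -> k y A = Q y (xsection A y).
  by move=> mA; rewrite xsectionE.
rewrite (@ge0_integral_mixture _ _ _ _ _ (q x) k)//; last 2 first.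
- move=> A mA; rewrite (_ : k^~ A = fun y => Q y (xsection A y)).
    by apply: measurable_fun_xsection_finite_kernel; rewrite inE.
  by apply/funext => y; rewrite kE.
- move=> A mA; apply: eq_integral => y _; rewrite kE//.
  by rewrite kernel.intker_indicE.
by apply: eq_integral => y _; rewrite ge0_integral_pushforward.
Qed.

(** The rejection probability is the average of [1 - a] over the proposal, which
spreads the rejection mass over the proposals: the kernel becomes the mixture of
the laws [a d_z' + (1 - a) d_z]. *)
Lemma integral_pm_kernel (z : XW) (f : XW -> R) :
    measurable_fun [set: XW] f -> (forall z', 0 <= f z')%R ->
  \int[pm_kernel r Q z]_z' (EFin \o f) z' =
  \int[pm_proposal q Q z.1]_z'
    (pm_accept r z z' * f z' + (1 - pm_accept r z z') * f z)%:E.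
Proof.
move=> mf f0; set m := pm_proposal q Q z.1; set a := pm_accept r z.
have a0 z' : (0 <= a z')%R := pm_accept_ge0 r z z'.
have a1 z' : (a z' <= 1)%R := pm_accept_le1 r z z'.
have ac0 z' : (0 <= 1 - a z')%R by rewrite subr_ge0.
have mfE : measurable_fun [set: XW] (EFin \o f) by exact/measurable_EFinP.
have f0E z' : 0 <= (EFin \o f) z' by rewrite lee_fin.
have ma : measurable_fun [set: XW] a := measurable_pm_accept r z.
have mac : measurable_fun [set: XW] (fun z' => 1 - a z')%R.
  exact: measurable_funB.
pose k z' : {measure set XW -> \bar R} := measure_add
  (mscale (NngNum (a0 z')) (\d_z')) (mscale (NngNum (ac0 z')) (\d_z)).
have kE A z' : k z' A = (a z')%:E * \d_z' A + (1 - a z')%:E * \d_z A.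
  exact: measure_addE.
have mk1 A : measurable A ->
    measurable_fun [set: XW] (fun z' => (a z')%:E * \d_z' A).
  move=> mA; apply: emeasurable_funM; first exact/measurable_EFinP.
  exact: measurable_fun_dirac.
have mk2 A : measurable A ->
    measurable_fun [set: XW] (fun z' => (1 - a z')%:E * \d_z A).
  move=> mA; apply: emeasurable_funM; first exact/measurable_EFinP.
  exact: measurable_cst.
rewrite (@ge0_integral_mixture _ _ _ _ _ m k)//.
- apply: eq_integral => z' _.
  rewrite ge0_integral_measure_add// !ge0_integral_mscale// !integral_dirac//.
  by rewrite !diracT !mul1e.
- move=> A mA; rewrite (_ : k^~ A = fun z' => (a z')%:E * \d_z' A + (1 - a z')%:E * \d_z A).
    by apply: emeasurable_funD; [exact: mk1|exact: mk2].
  by apply/funext => z'; rewrite kE.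
- move=> A mA; rewrite /pm_kernel/= /pm_kernel_fun -/m.
  under [RHS]eq_integral do rewrite kE.
  rewrite ge0_integralD//; last 4 first.
    by move=> z' _; rewrite mule_ge0// lee_fin.
    exact: mk1.
    by move=> z' _; rewrite mule_ge0// lee_fin.
    exact: mk2.
  congr (_ + _).
    rewrite [LHS]integral_mkcond; apply: eq_integral => z' _.
    by rewrite patchE diracE; case: ifPn => _; rewrite ?mule1 ?mule0.
  rewrite ge0_integralZr//; last 2 first.
    exact/measurable_EFinP.
    by move=> z' _; rewrite lee_fin.
  congr (_ * _); rewrite /pm_reject_prob -/m -/a.
  have ia : \int[m]_z' (a z')%:E \is a fin_num.
    rewrite ge0_fin_numE; last by apply: integral_ge0 => *; rewrite lee_fin.
    apply: (@le_lt_trans _ _ 1); last exact: ltry.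
    by have := pm_reject_prob_ge0 r Q z; rewrite sube_ge0 ?fin_num1 ?orbT.
  have <- : \int[m]_z' (a z')%:E + \int[m]_z' (1 - a z')%:E = 1.
    rewrite -ge0_integralD//; last 4 first.
      by move=> z' _; rewrite lee_fin.
      exact/measurable_EFinP.
      by move=> z' _; rewrite lee_fin.
      exact/measurable_EFinP.
    under eq_integral do rewrite -EFinD subrKC.
    by rewrite integral_cst//= pm_proposalT mule1.
  by rewrite addeAC subee// add0e.
Qed.

(** * Drift of the pseudo-marginal kernel *)

Definition truncated_weight (s : R) (u : weight_space W) : R :=
  (wval u * \1_(`]-oo, s]) (wval u))%R.

Lemma truncated_weight_ge0 s u : (0 <= truncated_weight s u)%R.
Proof. by rewrite mulr_ge0// wval_ge0. Qed.

Lemma measurable_truncated_weight s :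
  measurable_fun [set: weight_space W] (truncated_weight s).
Proof.
rewrite (_ : truncated_weight s = (fun t => t * \1_(`]-oo, s]) t)%R \o @wval R W)//.
apply: measurableT_comp; last exact: measurable_wval.
by apply: measurable_funM => //; exact: measurable_indic.
Qed.

Variables (phi : R -> R) (M : R).
Hypothesis phi_ge1 : (forall t, 0 <= t -> 1 <= phi t)%R.
Hypothesis phi_nd : ({in `[0, +oo[ &, {homo phi : s t / s <= t}})%R.
Hypothesis weight_mean : forall y, \int[Q y]_u (wval u)%:E = 1.
Hypothesis phi_mean_le : forall y, \int[Q y]_u (phi (wval u))%:E <= M%:E.

Let phi_wval_ge0 (u : weight_space W) : (0 <= phi (wval u))%R.
Proof. by rewrite (le_trans ler01)// phi_ge1// wval_ge0. Qed.

Let measurable_phi := @measurable_phi_wval R phi phi_nd W.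

(** Above [s] the weight [u] is at most [phi(u) / K], so that weights above [s]
contribute at most [M / K <= 1/2] to the mean 1. *)
Lemma truncated_weight_mean_ge K s y : (0 < K)%R -> (2 * M <= K)%R ->
    (forall t, s < t -> K * t <= phi t)%R ->
  (2^-1)%:E <= \int[Q y]_u (truncated_weight s u)%:E.
Proof.
move=> K0 MK sK.
have K0' : (0 <= K^-1)%R by rewrite invr_ge0 ltW.
have : \int[Q y]_u (wval u)%:E <=
    \int[Q y]_u ((truncated_weight s u)%:E + K^-1%:E * (phi (wval u))%:E).
  apply: ge0_le_integral => //.
  - by move=> u _; rewrite lee_fin wval_ge0.
  - by apply/measurable_EFinP; exact: measurable_wval.
  - apply: emeasurable_funD; last exact: measurable_funeM.
    by apply/measurable_EFinP; exact: measurable_truncated_weight.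
  - move=> u _; rewrite -EFinM -EFinD lee_fin /truncated_weight indicE.
    have [us|su] := leP (wval u) s.
      rewrite mem_set/= ?in_itv//= mulr1 lerDl.
      by rewrite mulr_ge0.
    rewrite memNset; last by rewrite /= in_itv/= leNgt su.
    by rewrite mulr0 add0r ler_pdivlMl// sK.
rewrite weight_mean ge0_integralD//; last 4 first.
- by move=> u _; rewrite lee_fin truncated_weight_ge0.
- by apply/measurable_EFinP; exact: measurable_truncated_weight.
- by move=> u _; rewrite -EFinM lee_fin mulr_ge0.
- exact: measurable_funeM.
rewrite ge0_integralZl//; last by move=> u _; rewrite lee_fin.
move=> le1.
have : 1 <= \int[Q y]_u (truncated_weight s u)%:E + (2^-1)%:E.
  apply: (le_trans le1); rewrite leeD2l//.
  apply: (@le_trans _ _ (K^-1%:E * M%:E)); first by rewrite lee_pmul2l// lte_fin invr_gt0.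
  by rewrite -EFinM lee_fin mulrC ler_pdivrMr//; lra.
rewrite -leeBlDr//; apply: le_trans.
by rewrite -EFinB lee_fin; lra.
Qed.

Lemma integral_pm_proposal_phi_le x c : (0 <= c)%R ->
  \int[pm_proposal q Q x]_z (c + phi (wval z.2))%:E <= (c + M)%:E.
Proof.
move=> c0.
have mphi2 : measurable_fun [set: XW] (fun z => (phi (wval z.2))%:E).
  exact: (measurableT_comp measurable_phi).
under eq_integral do rewrite EFinD.
rewrite ge0_integralD//; last by move=> z _; rewrite lee_fin.
rewrite integral_cst// pm_proposalT mule1 EFinD leeD2l//.
rewrite integral_pm_proposal//; last by move=> z; rewrite lee_fin.
apply: (@le_trans _ _ (\int[q x]_y (cst M%:E y))).
  apply: ge0_le_integral => //.
  - by move=> y _; apply: integral_ge0 => u _; rewrite lee_fin.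
  - rewrite /=; apply: (measurable_fun_integral_kernel (l := Q)) => //.
    exact: measurable_kernel.
by rewrite integral_cst// prob_kernel mule1.
Qed.

(** By the product structure of the proposal, a lower bound on the mean truncated
weight that is uniform in [y] factors out of the integral over [y], where it
multiplies the acceptance probability of the marginal chain. *)
Lemma integral_accepted_weight_ge x s c (alpha : R) : (0 <= c)%R ->
    alpha%:E <= mh_accept_prob r x ->
    (forall y, c%:E <= \int[Q y]_u (truncated_weight s u)%:E) ->
  (alpha * c)%:E <= \int[pm_proposal q Q x]_z
    (Num.min 1 (r (x, z.1)) * truncated_weight s z.2)%:E.
Proof.
move=> c0 alpha_le c_le.
have m0 y : (0 <= Num.min 1 (r (x, y)))%R by rewrite le_min ler01 ratio_ge0.
have mm : measurable_fun [set: X] (fun y => Num.min 1 (r (x, y)))%R.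
  apply: (measurable_minr (f := cst 1%R)); first exact: measurable_cst.
  apply: (measurableT_comp (ratio_measurable r)).
  exact: pair1_measurable.
have mtE : measurable_fun [set: weight_space W] (EFin \o truncated_weight s).
  by apply/measurable_EFinP; exact: measurable_truncated_weight.
rewrite integral_pm_proposal; last 2 first.
- apply/measurable_EFinP; apply: measurable_funM.
    exact: (measurableT_comp mm).
  exact: (measurableT_comp (measurable_truncated_weight s)).
- by move=> z; rewrite lee_fin mulr_ge0// truncated_weight_ge0.
rewrite EFinM (le_trans (lee_wpmul2r _ alpha_le))// /mh_accept_prob.
rewrite -ge0_integralZr//; last 2 first.
- exact/measurable_EFinP.
- by move=> y _; rewrite lee_fin.
have factor y :
    \int[Q y]_u (Num.min 1 (r (x, y)) * truncated_weight s u)%:E =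
    (Num.min 1 (r (x, y)))%:E * \int[Q y]_u (truncated_weight s u)%:E.
  under eq_integral do rewrite EFinM.
  rewrite ge0_integralZl//; first by move=> u _; rewrite lee_fin truncated_weight_ge0.
  by rewrite lee_fin.
under [leRHS]eq_integral do rewrite factor.
apply: ge0_le_integral => //.
- by move=> y _; rewrite mule_ge0// lee_fin.
- by apply: emeasurable_funM => //; exact/measurable_EFinP.
- apply: emeasurable_funM; first exact/measurable_EFinP.
  apply: (measurable_fun_integral_kernel (l := Q)) => //.
    exact: measurable_kernel.
  by move=> u; rewrite lee_fin truncated_weight_ge0.
- by move=> y _; rewrite lee_wpmul2l// lee_fin.
Qed.

Let integral_pm_phi x (w : weight_space W) :
  \int[pm_kernel r Q (x, w)]_z (phi (wval z.2))%:E =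
  \int[pm_proposal q Q x]_z (pm_accept r (x, w) z * phi (wval z.2)
     + (1 - pm_accept r (x, w) z) * phi (wval w))%:E.
Proof.
rewrite (@integral_pm_kernel (x, w) (fun z => phi (wval z.2)))//.
by apply/measurable_EFinP; exact: (measurableT_comp measurable_phi).
Qed.

Let measurable_pm_phi x (w : weight_space W) :
  measurable_fun [set: XW] (fun z => pm_accept r (x, w) z * phi (wval z.2)
     + (1 - pm_accept r (x, w) z) * phi (wval w))%R.
Proof.
have ma := measurable_pm_accept r (x, w).
apply: measurable_funD; apply: measurable_funM => //.
  by apply/measurable_EFinP; exact: (measurableT_comp measurable_phi).
exact: measurable_funB.
Qed.

Let pm_phi_ge0 x (w : weight_space W) z :
  (0 <= pm_accept r (x, w) z * phi (wval z.2)
     + (1 - pm_accept r (x, w) z) * phi (wval w))%R.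
Proof.
by rewrite addr_ge0// mulr_ge0// ?subr_ge0 ?pm_accept_ge0// pm_accept_le1.
Qed.

Lemma pm_kernel_phi_le x (w : weight_space W) :
  \int[pm_kernel r Q (x, w)]_z (phi (wval z.2))%:E <= (phi (wval w) + M)%:E.
Proof.
rewrite integral_pm_phi.
apply: le_trans (@integral_pm_proposal_phi_le x (phi (wval w)) _) => //.
apply: ge0_le_integral => //.
- by move=> z _; rewrite lee_fin.
- exact/measurable_EFinP.
- apply/measurable_EFinP; apply: measurable_funD => //.
  by apply/measurable_EFinP; exact: (measurableT_comp measurable_phi).
- move=> z _; rewrite lee_fin addrC lerD//.
    by rewrite ler_piMl// gerBl pm_accept_ge0.
  by rewrite ler_piMl// pm_accept_le1.
Qed.

(** Integrating [drift_pointwise] over the proposal.  The factor [alpha / 4] is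
the product of the lower bound [alpha / 2] on the mean accepted truncated weight
and of the [1 / 2] in the correction term. *)
Lemma pm_kernel_phi_drift x (w : weight_space W) (s alpha : R) :
    (0 < wval w)%R -> (0 <= s)%R -> (2 * phi s <= phi (wval w))%R ->
    alpha%:E <= mh_accept_prob r x ->
    (forall y, (2^-1)%:E <= \int[Q y]_u (truncated_weight s u)%:E) ->
  \int[pm_kernel r Q (x, w)]_z (phi (wval z.2))%:E <=
  (phi (wval w) + M - alpha / 4 * (phi (wval w) / wval w))%:E.
Proof.
move=> w0 s0 sw alpha_le half_le.
have h0 : (0 <= (2^-1 : R))%R by rewrite invr_ge0.
have := integral_accepted_weight_ge h0 alpha_le half_le.
pose c : R := (phi (wval w) / (2 * wval w))%R.
have c0 : (0 <= c)%R by rewrite divr_ge0// mulr_ge0// ltW.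
have m0 y : (0 <= Num.min 1 (r (x, y)))%R by rewrite le_min ler01 ratio_ge0.
have mm : measurable_fun [set: XW]
    (fun z => Num.min 1 (r (x, z.1)) * truncated_weight s z.2)%R.
  apply: measurable_funM; last exact: (measurableT_comp (measurable_truncated_weight s)).
  apply: (measurable_minr (f := cst 1%R)); first exact: measurable_cst.
  apply: (measurableT_comp (ratio_measurable r)).
  exact: (measurableT_comp (pair1_measurable x)).
set J := \int[_]_z _ => J_ge.
(* The correction term is kept on the left, so that only integrals of
   nonnegative functions occur. *)
suff : \int[pm_kernel r Q (x, w)]_z (phi (wval z.2))%:E + c%:E * J <=
    (phi (wval w) + M)%:E.
  move=> PJ.
  have : \int[pm_kernel r Q (x, w)]_z (phi (wval z.2))%:E
      + (c * (alpha / 2))%:E <= (phi (wval w) + M)%:E.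
    by apply: le_trans PJ; rewrite leeD2l// EFinM lee_wpmul2l.
  rewrite -leeBrDr// => /le_trans; apply; rewrite -EFinB lee_fin lerD2l lerN2.
  rewrite le_eqVlt; apply/orP; left; apply/eqP; rewrite /c.
  by field; rewrite gt_eqF.
apply: le_trans (@integral_pm_proposal_phi_le x (phi (wval w)) _) => //.
rewrite integral_pm_phi -ge0_integralZl//; last 2 first.
- exact/measurable_EFinP.
- by move=> z _; rewrite lee_fin mulr_ge0// truncated_weight_ge0.
rewrite -ge0_integralD//; last 4 first.
- by move=> z _; rewrite lee_fin.
- exact/measurable_EFinP.
- by move=> z _; rewrite mule_ge0// lee_fin mulr_ge0// truncated_weight_ge0.
- by apply: measurable_funeM; exact/measurable_EFinP.
apply: ge0_le_integral => //.
- move=> z _; apply: adde_ge0; first by rewrite lee_fin.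
  by rewrite mule_ge0// lee_fin mulr_ge0// truncated_weight_ge0.
- apply: emeasurable_funD; first exact/measurable_EFinP.
  by apply: measurable_funeM; exact/measurable_EFinP.
- apply/measurable_EFinP; apply: measurable_funD => //.
  by apply/measurable_EFinP; exact: (measurableT_comp measurable_phi).
- move=> z _; rewrite -EFinM -EFinD lee_fin.
  by apply: drift_pointwise => //; [exact: wval_ge0|exact: ratio_ge0].
Qed.

End kernels.

Theorem proposition30 (R : realType) (phi : R -> R) (alpha0 MW : R)
    (phi_ge1 : forall t, 0 <= t -> 1 <= phi t)
    (phi_nd : {in `[0, +oo[ &, {homo phi : s t / s <= t}})
    (phi_convex : convex_function (`[0, +oo[%classic : set R) phi)
    (phi_superlinear : limf_einf (fun t : R => (phi t / t)%:E) +oo%R = +oo%E)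
    (alpha0_gt0 : 0 < alpha0) :
  exists delta wbar : R, [/\ 0 < delta, 1 < wbar &
    forall (d : measure_display) (X : measurableType d)
      (pi : probability X R) (q : R.-pker X ~> X) (r : mh_ratio pi q)
      (W : weight_set R) (Q : R.-pker X ~> weight_space W),
    (forall x, \int[Q x]_w (wval w)%:E = 1)%E ->
    alpha0%:E = ereal_inf (range (mh_accept_prob r)) ->
    MW%:E = ereal_sup (range (fun x => \int[Q x]_w (phi (wval w))%:E)%E) ->
    forall (x : X) (w : weight_space W), 0 < wval w ->
    (\int[pm_kernel r Q (x, w)]_z (phi (wval z.2))%:E <=
     (phi (wval w) - delta * (phi (wval w) / wval w) * \1_(`[wbar, +oo[) (wval w)
      + MW * \1_(`]0, wbar[) (wval w))%:E)%E].
Proof.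
(* The slope [K] has three tasks: [K >= 1] forces [phi w >= w], [K >= 2 MW] gives
   truncated weights a mean of at least 1/2, and [K >= 8 MW / alpha0] lets half
   of the gain [alpha0 / 4 * (phi w / w)] absorb [MW].  The absolute values make
   [K] positive before a chain is given, hence before [MW] is known to be. *)
pose K := 1 + 2 * `|MW| + 8 * `|MW| / alpha0.
have MW0 : 0 <= `|MW| by [].
have MWle : MW <= `|MW| by exact: ler_norm.
have Ma0 : 0 <= 8 * `|MW| / alpha0 by rewrite divr_ge0 ?mulr_ge0// ltW.
have [s s0 sK] := superlinear_ge K phi_superlinear.
have K1 : 1 <= K by rewrite /K; lra.
have K0 : 0 < K by lra.
have MK : 2 * MW <= K by rewrite /K; lra.
(* Beyond this threshold, [w > s] and [phi w >= w >= 2 * phi s]. *)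
exists (alpha0 / 8), (1 + s + 2 * phi s).
have phis1 := phi_ge1 _ (ltW s0).
split; [lra|lra|].
move=> d X pi q r W Q weight_mean alpha0E MWE x w w0.
have phi_mean_le y : (\int[Q y]_u (phi (wval u))%:E <= MW%:E)%E.
  by rewrite MWE; apply: ereal_sup_ubound; exists y.
have alpha_le : (alpha0%:E <= mh_accept_prob r x)%E.
  by rewrite alpha0E; apply: ereal_inf_lbound; exists x.
rewrite !indicE; have [wbar_le|w_lt] := leP (1 + s + 2 * phi s) (wval w).
  rewrite mem_set/= ?in_itv/= ?wbar_le// memNset; last first.
    by rewrite /= in_itv/= w0/= ltNge wbar_le.
  rewrite mulr1 mulr0 addr0.
  have Kw : K * wval w <= phi (wval w) by apply: sK; lra.
  have wK : wval w <= K * wval w by rewrite ler_peMl// ltW.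
  have half_le y := truncated_weight_mean_ge phi_ge1 phi_nd weight_mean
    phi_mean_le y K0 MK sK.
  apply: le_trans (pm_kernel_phi_drift phi_ge1 phi_nd phi_mean_le w0 (ltW s0) _
    alpha_le half_le) _; first lra.
  rewrite lee_fin; set g := phi (wval w) / wval w.
  have : K <= g by rewrite ler_pdivlMr.
  have : 8 * `|MW| <= alpha0 * K.
    by rewrite -ler_pdivrMl// mulrC /K; lra.
  have := ler_wpM2l (ltW alpha0_gt0).
  move=> H H1 /H; lra.
rewrite memNset ?mem_set; last 2 first.
- by rewrite /= in_itv/= w0.
- by rewrite /= in_itv/= andbT leNgt w_lt.
rewrite mulr0 subr0 mulr1.
exact: pm_kernel_phi_le.
Qed.
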